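(* Let $Y$ be a closed subspace of co-dimension $1$ in the real Banach space $\ell_1$. Then $Y$ does not have property-$(SU)$ in $\ell_1$.
   Context: For a closed subspace $Y$ of a Banach space $X$, $Y^\perp=\{x^*\in X^*: x^*(y)=0\ \forall y\in Y\}$. $Y$ has property-$(SU)$ in $X$ if there is a closed subspace $G$ of $X^*$ with $X^*=G\oplus Y^\perp$ such that for each $x^*\in X^*$, $\|x^*\|>\|y^\#\|$ whenever $x^*=y^\#+y^\perp$ with $y^\#\in G$ and $0\neq y^\perp\in Y^\perp$. Here $\ell_1=\ell_1(\mathbb{N})$ is the infinite-dimensional sequence space. *)

(* Defs.v *)
From HB Require Import structures.
From mathcomp Require Import all_boot all_order all_algebra.
From mathcomp Require Import all_classical all_reals all_analysis.

Set Implicit Arguments.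
Unset Strict Implicit.
Unset Printing Implicit Defensive.

Import Order.TTheory GRing.Theory Num.Theory.
Import numFieldNormedType.Exports.

Local Open Scope classical_set_scope.
Local Open Scope ring_scope.

Section Ell1.
Variable R : realType.

Definition ell1_pred : {pred nat -> R} :=
  mem [set x : nat -> R | cvgn [normed series x]].

Record ell1 := Ell1 {
  ell1_seq :> nat -> R ;
  ell1_seqP : ell1_seq \in ell1_pred }.

HB.instance Definition _ := [isSub for ell1_seq].
HB.instance Definition _ := [Choice of ell1 by <:].

Lemma ell1_predP (x : nat -> R) :
  reflect (cvgn (series (fun n => `|x n|))) (x \in ell1_pred).
Proof. by apply: (iffP idP) => [/set_mem|h]; [|apply: mem_set]. Qed.

Lemma ell1_pred_bounded (x : nat -> R) (M : R) :
  (forall n, series (fun k => `|x k|) n <= M) -> x \in ell1_pred.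
Proof.
move=> xM; apply/ell1_predP; apply: nondecreasing_is_cvgn.
  by apply: nondecreasing_series => *.
by exists M => _ [n _ <-].
Qed.

Lemma ell1_submod_closed : submod_closed ell1_pred.
Proof.
split.
  by apply: (@ell1_pred_bounded _ 0) => n; rewrite /series/= big1// => i _; rewrite normr0.
move=> a x y /ell1_predP sx /ell1_predP sy; apply/ell1_predP.
apply: series_le_cvg (is_cvg_seriesD (is_cvg_seriesZ (k := `|a|) sx) sy).
- by [].
- by move=> n; rewrite addr_ge0// mulr_ge0.
- by move=> n; rewrite (le_trans (ler_normD _ _))// normrM.
Qed.

HB.instance Definition _ :=
  GRing.isSubmodClosed.Build R (nat -> R) ell1_pred ell1_submod_closed.
HB.instance Definition _ := [SubChoice_isSubLmodule of ell1 by <:].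

Definition ell1_norm (x : ell1) : R := limn [normed series x].

Lemma ell1_norm_ge (x : ell1) n : series (fun k => `|x k|) n <= ell1_norm x.
Proof.
apply: (nondecreasing_cvgn_le (u_ := series (fun k => `|x k|))).
  by apply: nondecreasing_series => *.
exact/ell1_predP/ell1_seqP.
Qed.

Lemma ell1_norm_le (x : ell1) (M : R) :
  (forall n, series (fun k => `|x k|) n <= M) -> ell1_norm x <= M.
Proof.
move=> xM; apply: limr_le; first exact/ell1_predP/ell1_seqP.
by near=> n; exact: xM.
Unshelve. all: by end_near. Qed.

Lemma ell1_normD (x y : ell1) : ell1_norm (x + y) <= ell1_norm x + ell1_norm y.
Proof.
apply: ell1_norm_le => n.
rewrite (le_trans _ (lerD (ell1_norm_ge x n) (ell1_norm_ge y n)))//.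
by rewrite /series/= -big_split ler_sum// => i _; exact: ler_normD.
Qed.

Lemma ell1_normZ (a : R) (x : ell1) : ell1_norm (a *: x) = `|a| * ell1_norm x.
Proof.
rewrite /ell1_norm.
have cx : cvgn (series (fun k => `|x k|)) by exact/ell1_predP/ell1_seqP.
apply: cvg_lim => //.
rewrite (_ : [normed _] = fun n => `|a| * series (fun k => `|x k|) n).
  by apply: cvgM cx; exact: cvg_cst.
apply/funext => n; rewrite /series/= mulr_sumr.
by apply: eq_bigr => i _; rewrite normrM.
Qed.

Lemma ell1_coord_le (x : ell1) n : `|x n| <= ell1_norm x.
Proof.
apply: le_trans (ell1_norm_ge x n.+1).
by rewrite /series/= big_nat_recr//= lerDr; exact: sumr_ge0.
Qed.

Lemma ell1_norm_eq0 (x : ell1) : ell1_norm x = 0 -> x = 0.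
Proof.
move=> x0; apply: val_inj; apply/funext => n /=; apply/eqP.
by rewrite -normr_le0 -x0 ell1_coord_le.
Qed.

HB.instance Definition _ :=
  Lmodule_isNormed.Build R ell1 ell1_normD ell1_normZ ell1_norm_eq0.

Lemma ell1_complete (F : set_system ell1) : ProperFilter F -> cauchy F -> cvg F.
Proof.
move=> FF Fc.
have coordB (x y : ell1) n : `|x n - y n| <= `|x - y|.
  exact: (ell1_coord_le (x - y) n).
have near_close e : 0 < e -> \forall x \near F, \forall y \near F, `|x - y| < e.
  move=> e0; have /cauchy_ballP/(_ _ e0) Fe := Fc.
  by apply: nearP_dep; move: Fe; rewrite -ball_normE.
have Fcvg n : cvg ((fun x : ell1 => x n) @ F).
  apply/cauchy_cvgP/cauchy_exP => e e0.
  have [x xe] := filter_ex (near_close _ e0).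
  exists (x n); apply: filterS xe => y xy.
  by apply: le_lt_trans xy; exact: coordB.
pose l n := lim ((fun x : ell1 => x n) @ F).
have key (e : R) : 0 < e -> {near F, forall x : ell1,
    forall n, series (fun k => `|x k - l k|) n <= e}.
  move=> e0; near=> x => n.
  have cS : (fun y : ell1 => series (fun k => `|x k - y k|) n) @ F -->
       series (fun k => `|x k - l k|) n.
    rewrite /series/=; apply: cvg_big => [|k _]; first exact: add_continuous.
    by apply: cvg_norm; apply: cvgB; [exact: cvg_cst|exact: Fcvg].
  rewrite -(cvg_lim _ cS)//; apply: limr_le; first by apply/cvg_ex; eexists; exact: cS.
  near=> y; apply: (le_trans (ell1_norm_ge (x - y) n)); apply/ltW.
  by near: y; near: x; exact: near_close.
have lP : l \in ell1_pred.
  have [x xl] := filter_ex (key 1 ltr01).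
  have xlP : (x : nat -> R) - l \in ell1_pred by exact: ell1_pred_bounded xl.
  by rewrite -(subKr (x : nat -> R) l) rpredB// ell1_seqP.
apply/cvg_ex; exists (Ell1 lP); apply/cvgrPdist_le => e e0.
near=> x; rewrite distrC; apply: ell1_norm_le; near: x; exact: key.
Unshelve. all: by end_near. Qed.

HB.instance Definition _ := Uniform_isComplete.Build ell1 ell1_complete.

End Ell1.

Section Dual.
Variables (R : realType) (X : normedModType R).

Definition dual_pred : {pred X -> R} :=
  mem [set f : X -> R | linear f /\ continuous f].

Record dual := Dual {
  dual_fun :> X -> R ;
  dual_funP : dual_fun \in dual_pred }.

HB.instance Definition _ := [isSub for dual_fun].
HB.instance Definition _ := [Choice of dual by <:].

Lemma dual_submod_closed : submod_closed dual_pred.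
Proof.
split.
  apply/mem_set; split; last exact: cst_continuous.
  by move=> a x y; rewrite /= scaler0 addr0.
move=> a f g /set_mem[lf cf] /set_mem[lg cg]; apply/mem_set; split.
  move=> b x y; rewrite !fctE lf lg !scalerDr !scalerA mulrC -!addrA.
  by congr (_ + _); rewrite addrCA.
move=> x; apply: cvgD; last exact: cg.
by apply: cvgZ; [exact: cvg_cst|exact: cf].
Qed.

HB.instance Definition _ :=
  GRing.isSubmodClosed.Build R (X -> R) dual_pred dual_submod_closed.
HB.instance Definition _ := [SubChoice_isSubLmodule of dual by <:].

Lemma dual_linear (f : dual) : linear f.
Proof. by have /set_mem[] := dual_funP f. Qed.

HB.instance Definition _ (f : dual) :=
  GRing.isLinear.Build R X R *:%R (dual_fun f) (dual_linear f).

Lemma dual_continuous (f : dual) : continuous f.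
Proof. by have /set_mem[] := dual_funP f. Qed.

Definition dual_norm (f : dual) : R := sup [set `|f x| | x in [set x : X | `|x| <= 1]].

Lemma dual_norm_has_sup (f : dual) :
  has_sup [set `|f x| | x in [set x : X | `|x| <= 1]].
Proof.
split; first by exists `|f 0|, 0 => //=; rewrite normr0.
have /linear_bounded_continuous/bounded_funP/(_ 1)[M fM] := @dual_continuous f.
by exists M => _ [x x1 <-]; exact: fM.
Qed.

Lemma dual_norm_ge (f : dual) (x : X) : `|x| <= 1 -> `|f x| <= dual_norm f.
Proof.
by move=> x1; apply: (sup_upper_bound (dual_norm_has_sup f)); exists x.
Qed.

Lemma dual_norm_le (f : dual) (M : R) :
  (forall x : X, `|x| <= 1 -> `|f x| <= M) -> dual_norm f <= M.
Proof.
move=> fM; apply: ge_sup; first by case: (dual_norm_has_sup f).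
by move=> _ [x x1 <-]; exact: fM.
Qed.

Lemma dual_normD (f g : dual) : dual_norm (f + g) <= dual_norm f + dual_norm g.
Proof.
apply: dual_norm_le => x x1.
by rewrite (le_trans (ler_normD _ _))// lerD// dual_norm_ge.
Qed.

Lemma dual_normZ (a : R) (f : dual) : dual_norm (a *: f) = `|a| * dual_norm f.
Proof.
have le b (g : dual) : dual_norm (b *: g) <= `|b| * dual_norm g.
  by apply: dual_norm_le => x x1; rewrite normrM ler_wpM2l// dual_norm_ge.
apply/eqP; rewrite eq_le le/=; have [->|a0] := eqVneq a 0.
  rewrite normr0 mul0r; apply: le_trans (dual_norm_ge _ (x := 0) _) => //.
  by rewrite normr0.
rewrite -ler_pdivlMl ?normr_gt0// -normfV.
by apply: le_trans (le _ _); rewrite scalerA mulVf// scale1r.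
Qed.

Lemma dual_norm_eq0 (f : dual) : dual_norm f = 0 -> f = 0.
Proof.
move=> f0; apply: val_inj; apply/funext => x /=.
have [->|x0] := eqVneq x 0; first by rewrite linear0.
have nx : `|x| != 0 by rewrite normr_eq0.
have : `|f (`|x|^-1 *: x)| <= 0.
  by rewrite -f0 dual_norm_ge// normrZ normfV normr_id mulVf.
by rewrite normr_le0 linearZ/= scaler_eq0 invr_eq0 (negbTE nx)/= => /eqP.
Qed.

HB.instance Definition _ :=
  Lmodule_isNormed.Build R dual dual_normD dual_normZ dual_norm_eq0.

End Dual.

Section PropertySU.
Variable R : realType.

Definition closed_subspace (X : normedModType R) (Y : set X) :=
  submod_closed [in Y] /\ closed Y.

(* The classes of the [v i] form a basis of the quotient of [X] by [Y]. *)
Definition has_codimension (X : lmodType R) (Y : set X) (n : nat) :=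
  exists v : 'I_n -> X,
    forall x : X, exists! c : 'rV[R]_n, Y (x - \sum_i c ord0 i *: v i).

Definition annihilator (X : normedModType R) (Y : set X) : set (dual X) :=
  [set f : dual X | forall y, Y y -> f y = 0].

Definition direct_sum_decomposition (V : lmodType R) (A B : set V) :=
  A `&` B = [set 0] /\ forall v : V, exists a b, [/\ A a, B b & v = a + b].

Definition property_SU (X : completeNormedModType R) (Y : set X) :=
  exists G : set (dual X),
    [/\ closed_subspace G,
        direct_sum_decomposition G (annihilator Y) &
        forall f g h : dual X, G g -> annihilator Y h -> h != 0 ->
          f = g + h -> `|g| < `|f| ].

End PropertySU.

(* Main.v *)
Require Import Defs.
From HB Require Import structures.
From mathcomp Require Import all_boot all_order all_algebra.
From mathcomp Require Import all_classical all_reals all_analysis.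
From mathcomp Require Import ring lra zify.

(** A functional [f] on l1 is seen through its coordinates [f (ell1_unit n)],
    and its norm is their supremum. As [Y] is a closed hyperplane, its
    annihilator is the line spanned by some [phi <> 0], with coordinates
    [p n], so a decomposition witnessing property (SU) is a complement [G] of
    that line such that [`|g| < `|g + t phi|] for all [g] in [G] and [t <> 0].
    In other words the projection [f |-> f - lam f * phi] onto [G], with
    [lam f] the scalar such that [G (f - lam f * phi)], strictly decreases the
    norm of every [f] outside [G].

    This is contradicted by the coordinates of [phi].

    - If [p n = p m = 0] with [n <> m], the plane spanned by the n-th and m-th
      coordinate functionals meets [G] in some [g <> 0]. Since [phi] lives on
      the other coordinates, adding a small multiple of [phi] does not change
      the norm of [g] ([no_common_zero], [zero_unique]). So at most one [p n]
      vanishes.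

    - Let [a] be a coordinate with [p a <> 0]. Testing the projection on
      combinations of three coordinate functionals with coefficients of
      absolute value at most 1, with signs chosen so that the a-th coordinate
      of the image exceeds 1, shows that [`|lam (e a)| > `|lam (e b)|] as soon
      as [lam (e c) <> 0] ([coefficient_lt]); and [lam (e c) <> 0] whenever
      [p c <> 0] ([coord_notin]).

    Three coordinates where [phi] does not vanish therefore give
    [`|lam (e a)| < `|lam (e b)| < `|lam (e a)|].

    The upper bounds on dual norms all come from [dual_norm_le_coords], which
    treats separately finitely many coordinates and the sequences that vanish
    on them. *)

Set Implicit Arguments.
Unset Strict Implicit.
Unset Printing Implicit Defensive.

Import Order.TTheory GRing.Theory Num.Theory.
Import numFieldNormedType.Exports.

Local Open Scope classical_set_scope.
Local Open Scope ring_scope.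

(** * Bounded functionals on a normed space *)

Section Functionals.
Variables (R : realType) (X : normedModType R).

Lemma bounded_dual_pred (f : X -> R) (M : R) :
  linear f -> (forall x, `|f x| <= M * `|x|) -> f \in @dual_pred R X.
Proof.
move=> lf fM; apply/mem_set; split=> //.
pose g : {linear X -> R} := HB.pack f (GRing.isLinear.Build R X R *:%R f lf).
have : continuous g.
  apply/linear_bounded_continuous/linear_boundedP.
  exists M; split=> [|r /ltW Mr x]; first exact: num_real.
  by apply: le_trans (fM x) _; exact: ler_wpM2r.
by [].
Qed.

Definition dual_of_bound (f : X -> R) (M : R) (lf : linear f)
  (fM : forall x, `|f x| <= M * `|x|) : dual X := Dual (bounded_dual_pred lf fM).

Lemma dual_norm_apply (f : dual X) (x : X) : `|f x| <= `|f| * `|x|.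
Proof.
have [->|x0] := eqVneq x 0; first by rewrite linear0 !normr0 mulr0.
have nx : 0 < `|x| by rewrite normr_gt0.
rewrite -ler_pdivrMr// mulrC -[X in X * _]gtr0_norm ?invr_gt0// -normrM.
rewrite -[_ * f x]/(_ *: f x) -linearZ.
by apply: dual_norm_ge; rewrite normrZ normfV normr_id mulVf ?gt_eqF.
Qed.

Lemma dual_norm_le_bound (f : dual X) (M : R) :
  0 <= M -> (forall x, `|f x| <= M * `|x|) -> `|f| <= M.
Proof.
move=> M0 fM; apply: dual_norm_le => x x1.
by rewrite (le_trans (fM x))// ler_piMr.
Qed.

(** The generator of the annihilator is the functional [c] for which
    [x - c x *: v] lies in [Y], where [v] spans a complement of [Y]. It is
    bounded because [v] is at positive distance [r] from [Y]: when [c x <> 0],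
    the vector [x / c x] differs from [v] by an element of [Y], so its norm is
    at least [r]. *)
Lemma hyperplane_annihilator (Y : set X) :
  closed_subspace Y -> has_codimension Y 1 ->
  exists phi : dual X, [/\ phi != 0, annihilator Y phi &
    forall h : dual X, annihilator Y h -> exists t, h = t *: phi].
Proof.
move=> [subY clY] [v0 codY]; pose v := v0 ord0.
have Y0 : Y 0 by have [/set_mem] := subY.
have YM a x y : Y x -> Y y -> Y (a *: x + y).
  by move=> Yx Yy; have [_ H] := subY; apply: set_mem (H a x y _ _); apply: mem_set.
have [c cP] : {c : X -> R & forall x, Y (x - c x *: v)}.
  apply: (choice (P := fun x t => Y (x - t *: v))) => x.
  by have [r [+ _]] := codY x; rewrite big_ord1; exists (r ord0 ord0).
have cU x t : Y (x - t *: v) -> t = c x.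
  move=> Yt; have [r [_ ru]] := codY x.
  have e u : Y (x - u *: v) -> r = const_mx u.
    by move=> Yu; apply: ru; rewrite big_ord1 mxE.
  have /(congr1 (fun m : 'rV[R]_1 => m ord0 ord0)) :=
    etrans (esym (e _ Yt)) (e _ (cP x)).
  by rewrite !mxE.
have cl : linear c.
  move=> a x y; apply/esym/cU.
  have -> : a *: x + y - (a *: c x + c y) *: v =
      a *: (x - c x *: v) + (y - c y *: v).
    by rewrite scalerDl opprD scalerBr scalerA addrACA.
  exact: YM.
have cv : c v = 1 by apply/esym/cU; rewrite scale1r subrr.
have nYv : ~ Y v by move=> Yv; have := cU v 0; rewrite scale0r subr0 cv => /(_ Yv); lra.
have [r r0 rY] : exists2 r : R, 0 < r & forall y, Y y -> r <= `|v - y|.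
  have : nbhs v (~` Y) by apply: open_nbhs_nbhs; split=> //; exact: closed_openC.
  move=> /nbhs_ballP[r /= r0 rY]; exists r => // y Yy.
  rewrite leNgt; apply/negP => vy; apply: (rY y) => //.
  by rewrite -ball_normE.
have cb x : `|c x| <= r^-1 * `|x|.
  have [->|c0] := eqVneq (c x) 0; first by rewrite normr0 mulr_ge0// invr_ge0 ltW.
  have := rY (v - (c x)^-1 *: x).
  have -> : v - (c x)^-1 *: x = - (c x)^-1 *: (x - c x *: v) + 0.
    by rewrite addr0 scalerBr scalerA mulNr mulVf// scaleNr scaleN1r opprK addrC.
  move=> /(_ (YM _ _ _ (cP x) Y0)).
  rewrite addr0 scalerBr scalerA mulNr mulVf// scaleN1r opprK scaleNr.
  rewrite opprD opprK addrC subrK normrZ normfV.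
  by rewrite mulrC ler_pdivlMr ?normr_gt0// ler_pdivlMl.
exists (dual_of_bound cl cb); split.
- apply/eqP => /(congr1 (fun f : dual X => f v)) /=.
  by rewrite cv => /eqP; rewrite oner_eq0.
- by move=> y Yy /=; apply/esym/cU; rewrite scale0r subr0.
- move=> h hY; exists (h v); apply: val_inj; apply/funext => x /=.
  have /eqP := hY _ (cP x).
  by rewrite linearB linearZ subr_eq0 => /eqP ->; exact: mulrC.
Qed.

End Functionals.

(** * Coordinates on the space of summable sequences *)

Section Coordinates.
Variable R : realType.
Implicit Types (x y : ell1 R) (f : dual (ell1 R)).

Fact ell1_unit_sum n N : series (fun k => `|(k == n)%:R : R|) N <= 1.
Proof.
rewrite /series/= big_mkord.
have [nN|Nn] := ltnP n N.
  rewrite (bigD1 (Ordinal nN))//= eqxx normr1 big1 ?addr0// => i /eqP ni.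
  rewrite [_ == n]negbTE ?normr0//; apply/eqP => e; apply: ni.
  exact: val_inj.
rewrite big1 ?ler01// => i _; rewrite [_ == n]ltn_eqF ?normr0//.
exact: leq_trans Nn.
Qed.

Fact ell1_unit_subproof n : (fun k => (k == n)%:R : R) \in @ell1_pred R.
Proof. exact: ell1_pred_bounded (ell1_unit_sum n). Qed.

Definition ell1_unit n : ell1 R := Ell1 (ell1_unit_subproof n).

Lemma ell1_unit_neq m n : m != n -> ell1_unit n m = 0.
Proof. by rewrite /ell1_unit/= => /negbTE ->. Qed.

(** The sequence [x] with its n-th entry replaced by zero. *)
Definition ell1_drop n x : ell1 R := x - x n *: ell1_unit n.

Lemma ell1_dropE n x k : ell1_drop n x k = x k - x n * (k == n)%:R.
Proof. by []. Qed.

(** The norm of l1 is additive over disjoint supports; this inequality is the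
    half that splits functionals along a coordinate. *)
Lemma ell1_norm_drop n x : `|ell1_drop n x| + `|x n| <= `|x|.
Proof.
rewrite -lerBrDr; apply: ell1_norm_le => N; rewrite lerBrDr.
(* The partial sum has to be long enough to contain the n-th term. *)
pose K := maxn N n.+1.
apply: le_trans (ell1_norm_ge x K).
have nK : (n < K)%N by rewrite /K leq_max ltnSn orbT.
apply: (@le_trans _ _ (series (fun k => `|ell1_drop n x k|) K + `|x n|)).
  rewrite lerD2r; apply: (nondecreasing_series (P := xpredT)); first by [].
  by rewrite leq_maxl.
have split_n (u : nat -> R) :
    series u K = u n + \sum_(i < K | i != Ordinal nK) u i.
  by rewrite /series/= big_mkord (bigD1 (Ordinal nK)).
rewrite !split_n.
rewrite ell1_dropE eqxx mulr1 subrr normr0 add0r addrC lerD2l.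
apply: ler_sum => i /eqP ni; rewrite ell1_dropE [_ == n]negbTE ?mulr0 ?subr0//.
by apply/eqP => e; apply: ni; exact: val_inj.
Qed.

Lemma ell1_norm_unit n : `|ell1_unit n| <= 1.
Proof. by apply: ell1_norm_le => N; exact: ell1_unit_sum. Qed.

Lemma dual_coord_le f n : `|f (ell1_unit n)| <= `|f|.
Proof. by apply: dual_norm_ge; exact: ell1_norm_unit. Qed.

(** The dual of an l1-sum is the sup-sum of the duals, here for the
    decomposition of l1 into finitely many coordinate lines and the space of
    sequences vanishing on these coordinates. Removing the coordinates one at
    a time makes it an induction on [s]. *)
Lemma dual_norm_le_coords f (s : seq nat) (M : R) : 0 <= M ->
  {in s, forall n, `|f (ell1_unit n)| <= M} ->
  (forall y, {in s, forall n, y n = 0} -> `|f y| <= M * `|y|) ->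
  `|f| <= M.
Proof.
move=> M0 fs fy; apply: dual_norm_le_bound => //.
elim: s fs fy => [|a s IH] fs fy; first by move=> x; exact: fy.
apply: IH => [n ns|y ys]; first by apply: fs; rewrite inE ns orbT.
have -> : f y = f (ell1_drop a y) + y a * f (ell1_unit a).
  by rewrite -[_ * f _]/(_ *: f _) -linearZ -linearD subrK.
apply: le_trans (ler_normD _ _) _.
apply: (@le_trans _ _ (M * (`|ell1_drop a y| + `|y a|))); last first.
  by rewrite ler_wpM2l// ell1_norm_drop.
rewrite mulrDr normrM (mulrC `|y a|) lerD//; last first.
  by rewrite ler_wpM2r// fs// mem_head.
apply: fy => n; rewrite inE ell1_dropE => /predU1P[->|ns].
  by rewrite eqxx mulr1 subrr.
rewrite ys//; case: eqVneq => [<-|_]; last by rewrite mulr0 subr0.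
by rewrite ys// mul0r subr0.
Qed.

Fact ell1_coord_linear n : linear (fun x => x n).
Proof. by []. Qed.

Fact ell1_coord_bound n x : `|x n| <= 1 * `|x|.
Proof. by rewrite mul1r; exact: ell1_coord_le. Qed.

Definition ell1_coord n : dual (ell1 R) :=
  dual_of_bound (@ell1_coord_linear n) (@ell1_coord_bound n).

Lemma ell1_coordE n x : ell1_coord n x = x n.
Proof. by []. Qed.

End Coordinates.

(** * Strictly norm-decreasing projections of rank-one kernel *)

Section Projection.
Variables (R : realType) (phi : dual (ell1 R)) (G : set (dual (ell1 R))).
Hypothesis phi0 : phi != 0.
Hypothesis Gsub : submod_closed [in G].
Hypothesis Gphi : forall f, exists t, G (f - t *: phi).
Hypothesis Gstrict : forall f t, G (f - t *: phi) -> t != 0 ->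
  `|f - t *: phi| < `|f|.

Let e := @ell1_coord R.
Let p n := phi (ell1_unit R n).

Let G0 : G 0. Proof. by have [/set_mem] := Gsub. Qed.

Let GD a f g : G f -> G g -> G (a *: f + g).
Proof.
by move=> Gf Gg; have [_ H] := Gsub; apply: set_mem (H a f g _ _); apply: mem_set.
Qed.

Let GZ a f : G f -> G (a *: f).
Proof. by move=> Gf; rewrite -[_ *: _]addr0; exact: GD. Qed.

Let eE n m : e n (ell1_unit R m) = (n == m)%:R. Proof. by []. Qed.

(** If [g] lives on coordinates where [phi] vanishes, then [g + t *: phi] has
    norm at most [`|g|] as long as [`|t| * `|phi| <= `|g|], which leaves room for
    some [t <> 0] and contradicts strictness. *)
Lemma no_common_zero (g : dual (ell1 R)) (s : seq nat) :
  G g -> g != 0 -> {in s, forall n, p n = 0} ->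
  ~ (forall y : ell1 R, {in s, forall n, y n = 0} -> g y = 0).
Proof.
move=> Gg g0 ps gs.
have nphi : 0 < `|phi| by rewrite normr_gt0.
pose t := `|g| / `|phi|.
have t0 : 0 < t by rewrite divr_gt0// normr_gt0.
suff : `|g + t *: phi| <= `|g|.
  apply/negP; rewrite -ltNge -{1}[g](addrK (t *: phi)).
  by apply: Gstrict; rewrite ?addrK// gt_eqF.
apply: (@dual_norm_le_coords _ _ s) => // [n ns|y ys].
  rewrite (_ : _ (ell1_unit R n) = g (ell1_unit R n)) ?dual_coord_le//.
  by rewrite -[RHS]addr0 -(mulr0 t) -(ps n ns).
rewrite (_ : _ y = t * phi y); last by rewrite -[RHS]add0r -(gs y ys).
rewrite normrM gtr0_norm//; apply: le_trans (ler_wpM2l (ltW t0) (dual_norm_apply _ _)) _.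
by rewrite mulrA divfK// gt_eqF.
Qed.

(** The functional [b *: e n - a *: e m] is in [G] because it is a combination
    of [e n - a *: phi] and [e m - b *: phi] in which [phi] cancels. *)
Lemma zero_unique n m : p n = 0 -> p m = 0 -> n = m.
Proof.
move=> pn pm; apply/eqP/negP => /negP nm.
have mn : m != n by rewrite eq_sym.
have ps : {in [:: n; m], forall k, p k = 0}.
  by move=> k; rewrite !inE => /orP[] /eqP ->.
have [a Ga] := Gphi (e n); have [b Gb] := Gphi (e m).
pose g := b *: e n - a *: e m.
have Gg : G g.
  rewrite (_ : g = b *: (e n - a *: phi) + - a *: (e m - b *: phi)).
    by apply: GD => //; exact: GZ.
  rewrite !scalerBr !scalerA !mulNr !scaleNr opprK (mulrC a b) -addrA.
  by congr (_ + _); rewrite addrCA addNr addr0.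
have gy (c d : R) (y : ell1 R) : {in [:: n; m], forall k, y k = 0} ->
    c * y n + d * y m = 0.
  by move=> ys; rewrite !ys ?mulr0 ?addr0// !inE eqxx ?orbT.
(* The combination could be zero when [a = 0], but then [e n] is in [G]. *)
have [a0|a0] := eqVneq a 0.
  apply: (@no_common_zero (e n) [:: n; m]) => //.
  - by move: Ga; rewrite a0 scale0r subr0.
  - apply/eqP => /(congr1 (fun f : dual _ => f (ell1_unit R n))).
    by rewrite eE eqxx => /eqP; rewrite oner_eq0.
  - by move=> y ys; rewrite /e ell1_coordE ys// mem_head.
apply: (@no_common_zero g [:: n; m]) => //.
- apply/eqP => /(congr1 (fun f : dual _ => f (ell1_unit R m))) /eqP.
  rewrite [X in X == _](_ : _ = b * (m == n)%:R - a * (m == m)%:R); last first.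
    by rewrite [m == n]eq_sym.
  by rewrite (negbTE mn) eqxx mulr0 mulr1 sub0r oppr_eq0 (negbTE a0).
- by move=> y /(gy b (- a)); rewrite mulNr.
Qed.

(** Suppose [e a] is in [G]. Then the a-th coordinate of [phi] can be changed
    at will without changing its component along [phi]. Replacing it by
    [- sg (p a) * `|phi|] gives [x] of norm at most [`|phi|] whose projection
    [x - phi] has a-th coordinate of absolute value [`|p a| + `|phi|]. *)
Lemma coord_notin a : p a != 0 -> ~ G (e a).
Proof.
move=> pa Ga.
pose x := phi - (p a + Num.sg (p a) * `|phi|) *: e a.
have xa : x (ell1_unit R a) = - (Num.sg (p a) * `|phi|).
  rewrite (_ : x _ = p a - (p a + Num.sg (p a) * `|phi|) * (a == a)%:R)//.
  by rewrite eqxx mulr1 opprD addrA subrr add0r.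
have xphi : x - 1 *: phi = - (p a + Num.sg (p a) * `|phi|) *: e a.
  by rewrite scale1r /x addrAC subrr add0r scaleNr.
have : `|x - 1 *: phi| < `|x|.
  by apply: Gstrict; rewrite ?oner_eq0// xphi; exact: GZ.
have xle : `|x| <= `|phi|.
  apply: (@dual_norm_le_coords _ _ [:: a]) => // [n|y ys].
    by rewrite inE => /eqP ->; rewrite xa normrN normrM normr_sg pa mul1r normr_id.
  rewrite (_ : x y = phi y - (p a + Num.sg (p a) * `|phi|) * y a)//.
  by rewrite ys ?mem_head// mulr0 subr0; exact: dual_norm_apply.
apply/negP; rewrite -leNgt; apply: le_trans xle _.
apply: le_trans (dual_coord_le _ a).
rewrite xphi (_ : _ (ell1_unit R a) = - (p a + Num.sg (p a) * `|phi|) * (a == a)%:R)//.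
rewrite eqxx mulr1 normrN {1}[p a]numEsg -mulrDr normrM normr_sg pa mul1r.
by rewrite ger0_norm ?addr_ge0// lerDr.
Qed.

(** If [`|al| <= `|be|], the functional [x] with coordinates 1, [sb] and [sc] at [a], [b]
    and [c] has norm at most 1, while the a-th coordinate of its projection is
    [1 - p a * T], where [T = al + sb * be + sc * ga] is its component along
    [phi]. The signs make [p a * T] at most
    [`|p a| * (`|al| - `|be| - `|ga|)], which is negative. *)
Lemma coefficient_lt a b c al be ga : p a != 0 -> uniq [:: a; b; c] ->
  G (e a - al *: phi) -> G (e b - be *: phi) -> G (e c - ga *: phi) ->
  ga != 0 -> `|be| < `|al|.
Proof.
move=> pa; rewrite /= !inE negb_or andbT => /andP[/andP[ab ac] bc] Ga Gb Gc ga0.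
rewrite ltNge; apply/negP => albe.
pose sb := - Num.sg (p a * be); pose sc := - Num.sg (p a * ga).
pose T := al + sb * be + sc * ga; pose x := e a + sb *: e b + sc *: e c.
have xE (y : ell1 R) : x y = y a + sb * y b + sc * y c by [].
have GT : G (x - T *: phi).
  rewrite (_ : _ - _ = sb *: (e b - be *: phi) +
      (sc *: (e c - ga *: phi) + (e a - al *: phi))); first by do 2 apply: GD => //.
  apply: val_inj; apply/funext => y /=.
  rewrite [LHS](_ : _ = x y - T * phi y)// [RHS](_ : _ = sb * (y b - be * phi y) +
      (sc * (y c - ga * phi y) + (y a - al * phi y)))// xE /T.
  ring.
have pT : p a * T < 0.
  have -> : p a * T = p a * al - `|p a| * `|be| - `|p a| * `|ga|.
    by rewrite -!normrM !normrEsg /T /sb /sc; ring.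
  have : p a * al <= `|p a| * `|be|.
    by rewrite (le_trans (ler_norm _))// normrM ler_wpM2l.
  have : 0 < `|p a| * `|ga| by rewrite mulr_gt0 ?normr_gt0.
  lra.
have T0 : T != 0 by apply: contraTneq pT => ->; rewrite mulr0 ltxx.
have sg1 (r : R) : `|- Num.sg r| <= 1 by rewrite normrN normr_sg lern1 leq_b1.
have x1 : `|x| <= 1.
  apply: (@dual_norm_le_coords _ _ [:: a; b; c]) => // [n|y ys]; last first.
    by rewrite xE !ys ?inE ?eqxx ?orbT// !mulr0 !addr0 normr0 mul1r.
  rewrite xE !inE => /or3P[] /eqP -> /=.
  - by rewrite eqxx (eq_sym b) (eq_sym c) (negbTE ab) (negbTE ac) !mulr0 !addr0 normr1.
  - rewrite eqxx (eq_sym c) (negbTE ab) (negbTE bc) mulr1 mulr0 addr0 add0r; exact: sg1.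
  - rewrite eqxx (negbTE ac) (negbTE bc) mulr1 mulr0 !add0r; exact: sg1.
have := Gstrict GT T0; apply/negP; rewrite -leNgt (le_trans x1)//.
apply: le_trans (dual_coord_le _ a).
rewrite (_ : _ (ell1_unit R a) = x (ell1_unit R a) - T * p a)// xE /=.
rewrite eqxx (eq_sym b) (eq_sym c) (negbTE ab) (negbTE ac) !mulr0 !addr0.
by rewrite mulrC (le_trans _ (ler_norm _))// lerDl oppr_ge0 ltW.
Qed.

(** By [zero_unique] all but finitely many coordinates of [phi] are nonzero,
    and [coefficient_lt] can be applied to three of them in two orders. *)
Lemma no_strict_projection : False.
Proof.
have [N pN] : exists N, forall n, (N <= n)%N -> p n != 0.
  have [[n0 pn0]|np] := pselect (exists n, p n = 0).
    exists n0.+1 => n; apply: contraTneq => pn.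
    by rewrite (zero_unique pn pn0) ltnn.
  by exists 0%N => n _; apply/eqP => pn; apply: np; exists n.
have pa := pN N (leqnn _); have pb := pN N.+1 (leqnSn _).
have pc : p N.+2 != 0 by apply: pN; rewrite ltnW.
have [al Ga] := Gphi (e N); have [be Gb] := Gphi (e N.+1).
have [ga Gc] := Gphi (e N.+2).
have ga0 : ga != 0.
  by apply/eqP => ga0; apply: (coord_notin pc); move: Gc; rewrite ga0 scale0r subr0.
have u1 : uniq [:: N; N.+1; N.+2] by rewrite /= !inE; lia.
have u2 : uniq [:: N.+1; N; N.+2] by rewrite /= !inE; lia.
have := lt_trans (coefficient_lt pa u1 Ga Gb Gc ga0)
                 (coefficient_lt pb u2 Gb Ga Gc ga0).
by rewrite ltxx.
Qed.

End Projection.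

Theorem theorem3p14 (R : realType) (Y : set (ell1 R)) :
  closed_subspace Y -> has_codimension Y 1 -> ~ property_SU Y.
Proof.
move=> clY codY [G [[Gsub _] [_ GY] Gstrict]].
have [phi [phi0 Yphi phiY]] := hyperplane_annihilator clY codY.
apply: (no_strict_projection phi0 Gsub) => [f|f t Gf t0].
  have [g [h [Gg /phiY[t ->] ->]]] := GY f.
  by exists t; rewrite addrK.
apply: (Gstrict f (f - t *: phi) (t *: phi)) => //.
- by move=> y Yy; rewrite -[RHS](mulr0 t) -(Yphi y Yy).
- by rewrite scaler_eq0 negb_or t0.
- by rewrite subrK.
Qed.
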